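(* Let $A$ be a semisimple Banach algebra, let $a\in\mathrm{Soc}(A)$, and suppose that $a$ assumes its rank on $\mathrm{comm}(a)$. If $b\in A$, then $d(a,b)=0$ if and only if $a-b$ is quasinilpotent and $a$ commutes with $b$.
   Context: Banach algebras are over $\mathbb{C}$ and have a unit $1$; $\sigma(x)$ is the spectrum of $x\in A$, $\sigma'(x)=\sigma(x)\setminus\{0\}$, and $x$ is quasinilpotent if $\sigma(x)=\{0\}$. For $a,b\in A$ let $C_{a,b}:A\to A$ be the bounded operator $C_{a,b}x=ax-xb$, put $\rho(a,b)=\limsup_{n\to\infty}\|C_{a,b}^n1\|^{1/n}$ and $d(a,b)=\max\{\rho(a,b),\rho(b,a)\}$. $\mathrm{Soc}(A)$ (the socle) is the two-sided ideal of all finite sums of rank one elements, where $0\neq u\in A$ is rank one if $uAu\subseteq\mathbb{C}u$ (the zero element is included as the empty sum). $\mathrm{comm}(a)=\{y\in A: ya=ay\}$. For $a\in A$, $\mathrm{rank}(a)=\sup_{x\in A}\#\sigma'(xa)\le\infty$, where $\#K$ is the number of distinct elements of $K\subseteq\mathbb{C}$; $\mathrm{rank}(a)$ is finite for $a\in\mathrm{Soc}(A)$. One says $a$ assumes its rank on $\mathrm{comm}(a)$ if there is $y\in\mathrm{comm}(a)$ with $\#\sigma'(ya)=\mathrm{rank}(a)$. *)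

(* Defs.v *)
From HB Require Import structures.
From mathcomp Require Import all_boot all_order all_algebra.
From mathcomp Require Import complex.
From mathcomp Require Import all_classical all_reals all_analysis.
Set Implicit Arguments.
Unset Strict Implicit.
Unset Printing Implicit Defensive.
Import Order.TTheory GRing.Theory Num.Theory.
Import numFieldNormedType.Exports.
Local Open Scope classical_set_scope.
Local Open Scope complex_scope.
Local Open Scope ring_scope.

(* A record rather than an HB structure: NumDomain already inherits from both
   normed modules and rings, so HB rejects a further join of the two.  The
   carrier receives both library structures, on the same underlying module,
   through the instances below.  `|1| = 1 is not required. *)
Record banachAlgType (K : numFieldType) := BanachAlgType {
  ba_base : completeNormedModType K;
  ba_one : ba_base;
  ba_mul : ba_base -> ba_base -> ba_base;
  ba_mulA : associative ba_mul;
  ba_mul1 : left_id ba_one ba_mul;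
  ba_mulr1 : right_id ba_one ba_mul;
  ba_mulDl : left_distributive ba_mul +%R;
  ba_mulDr : right_distributive ba_mul +%R;
  ba_oner_neq0 : ba_one != 0;
  ba_scalerAl : forall (k : K) x y, k *: ba_mul x y = ba_mul (k *: x) y;
  ba_scalerAr : forall (k : K) x y, k *: ba_mul x y = ba_mul x (k *: y);
  ba_ler_normM : forall x y, `|ba_mul x y| <= `|x| * `|y| }.

Definition ba_sort (K : numFieldType) (A : banachAlgType K) : Type :=
  ba_base A.
Coercion ba_sort : banachAlgType >-> Sortclass.

Section BanachAlgebraInstances.
Variables (K : numFieldType) (A : banachAlgType K).

HB.instance Definition _ := CompleteNormedModule.copy (ba_sort A) (ba_base A).
HB.instance Definition _ := GRing.Zmodule_isNzRing.Build (ba_sort A)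
  (@ba_mulA K A) (@ba_mul1 K A) (@ba_mulr1 K A) (@ba_mulDl K A)
  (@ba_mulDr K A) (@ba_oner_neq0 K A).
HB.instance Definition _ :=
  GRing.Lmodule_isLalgebra.Build K (ba_sort A) (@ba_scalerAl K A).
HB.instance Definition _ :=
  GRing.Lalgebra_isAlgebra.Build K (ba_sort A) (@ba_scalerAr K A).

(* [GRing.unit] is two-sided invertibility; see [unitrP]. *)
Let is_inv (x y : A) : Prop := y * x = 1 /\ x * y = 1.
Let unit (x : A) : bool := `[< exists y, is_inv x y >].
Let inv (x : A) : A := xget x (is_inv x).

Let invP x : unit x -> is_inv x (inv x).
Proof. by move=> /asboolP[y xy]; exact: (xgetPex x (ex_intro _ y xy)). Qed.

Let mulVx : {in unit, left_inverse 1 inv *%R}.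
Proof. by move=> x /invP[]. Qed.

Let mulxV : {in unit, right_inverse 1 inv *%R}.
Proof. by move=> x /invP[]. Qed.

Let unitxP (x y : A) : y * x = 1 /\ x * y = 1 -> unit x.
Proof. by move=> xy; apply/asboolP; exists y. Qed.

Let inv_out : {in [predC unit], inv =1 id}.
Proof.
move=> x; rewrite inE /= => /asboolPn xN.
by rewrite /inv; case: xgetP => // y _ xy; case: xN; exists y.
Qed.

HB.instance Definition _ :=
  GRing.NzRing_hasMulInverse.Build (ba_sort A) mulVx mulxV unitxP inv_out.

Lemma ler_normM (x y : A) : `|x * y| <= `|x| * `|y|.
Proof. exact: ba_ler_normM. Qed.

End BanachAlgebraInstances.

Section BanachAlgebraDefs.
Variables (R : realType) (A : banachAlgType R[i]).
Implicit Types (a b u x y : A) (J : {pred A}).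

Definition spectrum x : set R[i] := [set z | (z%:A : A) - x \isn't a GRing.unit].

Definition nz_spectrum x : set R[i] := spectrum x `\ 0.

Definition quasinilpotent x : Prop := spectrum x = [set 0].

(* [idealr_closed] is closure under 0 and a * u + v, together with 1 \notin J:
   it characterizes the proper left ideals. *)
Definition maximal_left_ideal J : Prop :=
  idealr_closed J /\
  forall J' : {pred A}, idealr_closed J' -> {subset J <= J'} ->
    {subset J' <= J}.

Definition jacobson_radical : set A :=
  [set x | forall J, maximal_left_ideal J -> x \in J].

Definition semisimple : Prop := jacobson_radical = [set 0].

(* The norm of A takes its values in R[i]; they are nonnegative reals. *)
Definition rnorm x : R := complex.Re `|x|.

Definition commop a b x : A := a * x - x * b.

(* The value of the sequence at n = 0 (where 0^-1 = 0) does not affect the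
   limsup. *)
Definition rho a b : \bar R :=
  limn_esup (fun n => (rnorm (iter n (commop a b) 1) `^ n%:R^-1)%:E).

Definition dist_rho a b : \bar R := maxe (rho a b) (rho b a).

Definition rank_one u : Prop :=
  u != 0 /\ forall x, exists z : R[i], u * x * u = z *: u.

Definition socle : set A :=
  [set x | exists2 s : seq A, (forall u, u \in s -> rank_one u) &
                              x = \sum_(u <- s) u].

Definition comm a : set A := [set y | y * a = a * y].

(* [counting] is the cardinality of a finite set, and +oo on infinite sets. *)
Definition rank a : \bar R :=
  ereal_sup [set counting (nz_spectrum (x * a)) | x in [set: A]].

Definition assumes_rank_on_comm a : Prop :=
  exists2 y, comm a y & counting (nz_spectrum (y * a)) = rank a.

End BanachAlgebraDefs.

Arguments socle {R} A _.

(* Main.v *)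
From mathcomp Require Import all_boot all_order all_algebra.
From mathcomp Require Import complex ring lra.
From mathcomp Require Import all_classical all_reals all_analysis.
Require Import Defs.
Set Implicit Arguments.
Unset Strict Implicit.
Unset Printing Implicit Defensive.
Import Order.TTheory GRing.Theory Num.Theory.
Import numFieldNormedType.Exports.
Import ComplexField.Normc.
Local Open Scope classical_set_scope.
Local Open Scope complex_scope.
Local Open Scope ring_scope.

(** Why the theorem holds.  An element c = y a with y in comm(a) that realizes
    the rank of a has the largest number of nonzero spectral values that a left
    multiple of a can have.  Elements of the socle are algebraic
    ([sum_thin_algebraic]), so c has polynomial idempotents e, one for each root
    of a polynomial killing c, with product of the 1 - e equal to 0.  Each e
    commutes with a, and maximality forces a e to be a scalar multiple of e
    ([block_scalar]): otherwise semisimplicity provides a left multiple of a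
    that agrees with c off the block e, keeps the eigenvalue of c on e if that
    is nonzero, and has one more eigenvalue, which can be moved to any chosen
    scalar.  Hence a is diagonalizable ([scalar_blocks]).

    If d(a, b) = 0, e a = alpha e and a f = beta f, then
    e C_{a,b}^n 1 = e (alpha - b)^n and C_{b,a}^n 1 f = (b - beta)^n f both
    decay faster than every geometric sequence.  When alpha differs from beta,
    expanding ((alpha - b) + (b - beta))^n between e and f gives e b f = 0
    ([separated_blocks]).  So e (a b - b a) f = (alpha - beta) e b f vanishes
    for all blocks e, f, and a commutes with b.  Once a and b commute,
    C_{a,b}^n 1 = (a - b)^n, and what remains, in both directions, is that x is
    quasinilpotent exactly when ||x^n||^(1/n) tends to 0.

    For that equivalence, decay of the powers gives invertibility of 1 - y by
    the Neumann series.  The converse is proved without complex integration: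
    (1 - (z x)^(2^m))^-1 is the mean of the resolvent (1 - z x)^-1 over the
    rotations of z by the 2^m-th roots of unity, so it satisfies on each disc
    the same norm and Lipschitz bounds as the resolvent, for all m at once
    ([dyadic_averaging]); this lets the set of radii r with
    r^(2^m) ||x^(2^m)|| bounded grow by fixed steps ([power_small]). *)

(** * Algebraic elements and their eigenvectors *)

Section AlgebraicElements.
Variables (K : closedFieldType) (A : unitAlgType K).
Implicit Types (a b c e h k l s u v w x y z : A) (p q : {poly K}).

Definition algebraic s : Prop := exists2 p, p != 0 & horner_alg s p = 0.

Lemma horner_alg_XsubC s (r : K) : horner_alg s ('X - r%:P) = s - r%:A.
Proof. by rewrite rmorphB /= horner_algX horner_algC. Qed.

Lemma horner_algZ s r p : horner_alg s (r *: p) = r *: horner_alg s p.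
Proof. by rewrite -mul_polyC rmorphM /= horner_algC mulr_algl. Qed.

Lemma horner_alg_comm s y p :
  s * y = y * s -> horner_alg s p * y = y * horner_alg s p.
Proof.
move=> sy; elim/poly_ind: p => [|p r IH]; first by rewrite rmorph0 mul0r mulr0.
rewrite rmorphD rmorphM /= horner_algX horner_algC mulrDl mulrDr -mulrA sy.
by rewrite mulrA IH !mulrA -scalerAl -scalerAr mul1r mulr1.
Qed.

Lemma horner_alg_eigen s k (r : K) p :
  s * k = r *: k -> horner_alg s p * k = p.[r] *: k.
Proof.
move=> sk; elim/poly_ind: p => [|p t IH].
  by rewrite rmorph0 mul0r horner0 scale0r.
rewrite rmorphD rmorphM /= horner_algX horner_algC mulrDl -mulrA sk.
by rewrite -scalerAr IH -scalerAl mul1r scalerA !hornerE -scalerDl mulrC.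
Qed.

(** Multiplying e successively by the factors c - r produces 0 at some point;
    the last nonzero product is an eigenvector of left multiplication by c.  It
    is recorded as a polynomial in c times e so that whatever commutes with c
    can be moved past it. *)
Lemma prod_XsubC_kernel c (rs : seq K) e :
  e != 0 -> horner_alg c (\prod_(r <- rs) ('X - r%:P)) * e = 0 ->
  exists r q, [/\ r \in rs, horner_alg c q * e != 0 &
                  c * (horner_alg c q * e) = r *: (horner_alg c q * e)].
Proof.
move=> e0; elim: rs => [|r rs IH].
  by rewrite big_nil rmorph1 mul1r => /eqP; rewrite (negPf e0).
rewrite big_cons; set q := \prod_(_ <- _) _ => qe0.
have [/IH [r' [q' [r'rs ? ?]]]|qe] := eqVneq (horner_alg c q * e) 0.
  by exists r', q'; split=> //; rewrite inE r'rs orbT.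
exists r, q; split=> //; first by rewrite mem_head.
apply/eqP; rewrite -subr_eq0 -[r *: _]mul1r -scalerAr scalerAl -mulrBl.
by rewrite -horner_alg_XsubC mulrA -rmorphM qe0.
Qed.

Lemma algebraic_eigenvector a e : algebraic a -> e != 0 ->
  exists r q, horner_alg a q * e != 0 /\
              a * (horner_alg a q * e) = r *: (horner_alg a q * e).
Proof.
move=> [p p0 pa] e0; have [rs prs] := closed_field_poly_normal p.
have : horner_alg a (\prod_(r <- rs) ('X - r%:P)) * e = 0.
  have lp : lead_coef p != 0 by rewrite lead_coef_eq0.
  by apply: (scalerI lp); rewrite scalerAl -horner_algZ -prs pa mul0r scaler0.
by move=> /(prod_XsubC_kernel e0) [r [q [_ ? ?]]]; exists r, q.
Qed.

Lemma eigenvalue_spectrum s l (r : K) :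
  l != 0 -> s * l = r *: l -> r%:A - s \isn't a GRing.unit.
Proof.
move=> l0 sl; apply: contra l0 => ru; apply/eqP.
rewrite -[l](mulKr ru) mulrBl sl -scalerAl mul1r subrr mulr0 //.
Qed.

(** Write p = (X - r)^m q with q(r) != 0.  If q(s) = 0, dividing q - q(r) by
    X - r inverts r - s; otherwise (s - r)^m kills q(s) and the kernel lemma
    applies. *)
Lemma spectrum_eigenvalue s (r : K) :
  algebraic s -> r%:A - s \isn't a GRing.unit ->
  exists2 l, l != 0 & s * l = r *: l.
Proof.
move=> [p p0 ps] rs.
have [m [q /implyP/(_ p0) qr pE]] := multiplicity_XsubC p r.
have [qs|qs] := eqVneq (horner_alg s q) 0; last first.
  have := @prod_XsubC_kernel s (nseq m r) (horner_alg s q) qs.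
  rewrite -rmorphM big_nseq.
  have -> : iter m ( *%R ('X - r%:P)) 1 = ('X - r%:P) ^+ m.
    by elim: m {pE} => //= m ->; rewrite exprS.
  rewrite mulrC -pE => /(_ ps) [r' [q' [/nseqP [-> _] ? ?]]].
  by exists (horner_alg s q' * horner_alg s q).
exfalso; move/negP: rs; apply.
have /factor_theorem [d qd] : root (q - q.[r]%:P) r.
  by rewrite /root !hornerE subrr.
pose w := (q.[r])^-1 *: horner_alg s d.
have E : w * (r%:A - s) = 1.
  rewrite -opprB mulrN -horner_alg_XsubC -scalerAl -rmorphM -qd rmorphB /= qs.
  rewrite horner_algC sub0r scalerN opprK scalerA mulVf ?scale1r//.
apply/unitrP; exists w; split=> //.
rewrite -[RHS]E /w -scalerAl -scalerAr; congr (_ *: _); apply/esym.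
apply: horner_alg_comm.
by rewrite mulrBl mulrBr -scalerAl -scalerAr mul1r mulr1.
Qed.

Lemma algebraic_spectrum_finite s : algebraic s ->
  exists rs : seq K, forall r, r%:A - s \isn't a GRing.unit -> r \in rs.
Proof.
move=> salg; have [p p0 ps] := salg.
have [rs prs] := closed_field_poly_normal p; exists rs => r.
move=> /(spectrum_eigenvalue salg) [l l0] /(horner_alg_eigen p).
rewrite ps mul0r => /esym/eqP; rewrite scaler_eq0 (negPf l0) orbF.
rewrite prs hornerZ mulf_eq0 lead_coef_eq0 (negPf p0) -/(root _ _).
by rewrite root_prod_XsubC.
Qed.

(** The N + 1 first of these powers lie in the span of N vectors, so a row of
    the kernel of their coordinate matrix is a polynomial relation; the shift n
    becomes a factor 'X^n. *)
Lemma algebraic_of_span (I : finType) (w : I -> A) s (n : nat) :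
  (forall i, exists f : I -> K, s ^+ (i + n) = \sum_j f j *: w j) ->
  algebraic s.
Proof.
move=> /choice [f fE]; set N := #|I|.
pose M := \matrix_(i < N.+1, j < N) f i (enum_val j).
have : kermx M != 0 by rewrite kermx_eq0 /row_free neq_ltn ltnS rank_leq_col.
move=> /matrix0Pn [i0 [j0 v0]].
pose v (i : 'I_N.+1) := kermx M i0 i.
have vM j : \sum_i v i * f i j = 0.
  have /matrixP/(_ i0 (enum_rank j)) := mulmx_ker M.
  rewrite mxE [RHS]mxE => vM.
  by rewrite -[RHS]vM; apply: eq_bigr => i _; rewrite [M i _]mxE enum_rankK.
exists ((\poly_(i < N.+1) v (inord i)) * 'X^n).
  apply: mulf_neq0; last by rewrite -size_poly_eq0 size_polyXn.
  apply: contra v0 => /eqP/polyP/(_ j0).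
  by rewrite coef_poly ltn_ord inord_val coef0 -/(v j0) => ->.
rewrite rmorphM rmorphXn poly_def rmorph_sum /= horner_algX mulr_suml.
rewrite (eq_bigr (fun i => \sum_j (v i * f i j) *: w j)) => [|i _].
  rewrite exchange_big /= big1 // => j _.
  by rewrite -scaler_suml vM scale0r.
rewrite horner_algZ rmorphXn /= horner_algX inord_val -scalerAl -exprD fE.
by rewrite scaler_sumr; apply: eq_bigr => j _; rewrite scalerA.
Qed.

End AlgebraicElements.

(** * Diagonalizability from maximal rank *)

Section Semiprimitive.
Variables (K : numClosedFieldType) (A : unitAlgType K).
Implicit Types (a b c e h k l s u v w x y z : A) (p q : {poly K}).

Hypothesis semiprim :
  forall h, h != 0 -> exists x, 1 - x * h \isn't a GRing.unit.

(** The rank one elements together with 0; including 0 makes the class stable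
    under left multiplication. *)
Definition thin u := forall x, exists z : K, u * x * u = z *: u.

Lemma thinMl x u : thin u -> thin (x * u).
Proof.
move=> uT w; have [z uz] := uT (w * x); exists z.
by rewrite scalerAr -uz !mulrA.
Qed.

(** If w r w = 0 for all r then x w has square 0, so 1 - x w is invertible
    for every x. *)
Lemma semiprim_semiprime w : (forall r, w * r * w = 0) -> w = 0.
Proof.
move=> w0; apply/eqP; apply: contraT => /semiprim [x /negP []].
apply/unitrP; exists (1 + x * w).
have xw : x * w * (x * w) = 0 by rewrite -mulrA (mulrA w) w0 mulr0.
split; first by rewrite mulrDl !mulrBr !mul1r !mulr1 xw subr0 subrK.
by rewrite mulrBl !mulrDr !mul1r !mulr1 xw addr0 addrK.
Qed.

(** u A v is at most a line.  If w = u x0 v is nonzero, semiprimeness gives r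
    with w r w != 0; then u x (v r u x0 v) can be computed by first collapsing
    v (r u x0) v to a nonzero multiple of v, or by first collapsing u (x v r) u
    to a multiple of u, and comparing shows that u x v is a multiple of w. *)
Lemma thin_pair u v : thin u -> thin v ->
  exists w, forall x, exists z : K, u * x * v = z *: w.
Proof.
move=> uT vT.
have [[x0 /eqP w0]|/forallNP uv0] :=
    pselect (exists x, u * x * v <> 0); last first.
  by exists 0 => x; exists 0; rewrite scaler0; apply: contrapT (uv0 x).
exists (u * x0 * v) => x; set w := u * x0 * v in w0 *.
have [r wrw] : exists r, w * r * w != 0.
  apply: contrapT => /forallNP wr; case/eqP: w0; apply: semiprim_semiprime => r.
  by apply/eqP; apply: contraT => /(wr r).
have [z2 z2E] := vT (r * u * x0).
have z20 : z2 != 0.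
  apply: contra wrw => /eqP z0; rewrite z0 scale0r in z2E.
  by rewrite /w -!mulrA in z2E *; rewrite z2E !mulr0.
have [z1 z1E] := uT (x * v * r).
exists (z2^-1 * z1); apply: (scalerI z20).
rewrite scalerA mulrA mulfV // mul1r scalerAr -z2E /w -!mulrA.
by rewrite -!mulrA in z1E; rewrite !scalerAl -z1E !mulrA.
Qed.

(** s^(n+2) is the sum of the u_i s^n u_j, each in the line u_i A u_j, so
    these powers all lie in one finite-dimensional space. *)
Lemma sum_thin_algebraic (us : seq A) :
  (forall u, u \in us -> thin u) -> algebraic (\sum_(u <- us) u).
Proof.
move=> usT; set s := \sum_(u <- us) u; pose m := size us.
have nthT (i : 'I_m) : thin us`_i by apply/usT/mem_nth.
have /choice [W WE] : forall ij : 'I_m * 'I_m, exists w, forall x,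
    exists z : K, us`_ij.1 * x * us`_ij.2 = z *: w.
  by move=> ij; apply: thin_pair.
apply: (@algebraic_of_span _ _ _ W s 2) => n.
have /choice [f fE] : forall ij : 'I_m * 'I_m, exists z : K,
    us`_ij.1 * s ^+ n * us`_ij.2 = z *: W ij by move=> ij; apply: WE.
exists f; rewrite addn2 exprS exprSr mulrA.
rewrite {1 3}/s (big_nth 0) big_mkord -/m mulr_suml mulr_suml.
rewrite -(eq_bigr _ (fun ij _ => fE ij)).
rewrite -(pair_bigA _ (fun i j : 'I_m => us`_i * s ^+ n * us`_j)).
by apply: eq_bigr => i _; rewrite mulr_sumr.
Qed.

Lemma fresh_scalar (rs : seq K) : exists2 r : K, r != 0 & r \notin rs.
Proof.
have [m m0 mP] : exists2 m : K, 0 <= m & forall r, r \in rs -> `|r| <= m.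
  elim: rs => [|r rs [m m0 mP]]; first by exists 0.
  exists (`|r| + m) => [|r']; first by rewrite addr_ge0.
  rewrite inE => /predU1P [->|/mP r'm]; first by rewrite lerDl.
  by apply: le_trans r'm _; rewrite lerDr.
have m1 : 0 < m + 1 by rewrite ltr_wpDl.
exists (m + 1); first by rewrite gt_eqF.
apply/negP => /mP; rewrite gtr0_norm // => /le_gtF.
by rewrite ltrDl ltr01.
Qed.

Section Block.
Variables (a y : A).
Let c := y * a.
Let in_spec x (r : K) := r%:A - x \isn't a GRing.unit.

Hypothesis alg_a : forall x, algebraic (x * a).
Hypothesis ya : y * a = a * y.
(** What maximality of the finite set of nonzero spectral values of c among all
    left multiples of a amounts to: such a set cannot be enlarged. *)
Hypothesis maxa : forall x (g : K),
  (forall r, r != 0 -> in_spec c r -> in_spec (x * a) r) ->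
  g != 0 -> in_spec (x * a) g -> in_spec c g.

(** For the application e is the spectral idempotent of c = y a at the root r,
    so eigenvectors of c for other nonzero eigenvalues are killed by e, and e is
    a left multiple of a when r is nonzero.  Take al to be an eigenvalue of a on
    e (or 0 if r = 0) and suppose h = a e - al e is nonzero.  Some x h has
    eigenvalue 1, and X a = c (1 - e) + r e + (t - r) e x h has all the nonzero
    eigenvalues of c and the free eigenvalue t as well. *)
Lemma block_scalar e (r : K) :
  e * e = e -> e * a = a * e ->
  (forall r' k, r' != 0 -> r' != r -> c * k = r' *: k -> e * k = 0) ->
  (r != 0 -> exists f, f * a = e) ->
  exists al : K, a * e = al *: e.
Proof.
move=> ee ea ek0 fa.
have [->|e0] := eqVneq e 0; first by exists 0; rewrite mulr0 scaler0.
(* Both r e and h must be left multiples of a, for X a to be one. *)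
have [al [d [g [da gE rk]]]] : exists al d g,
    [/\ d * a = r *: e, g * a = a * e - al *: e &
        r != 0 -> exists k, [/\ k != 0, e * k = k & a * k = al *: k]].
  have [->|/fa [f fE]] := eqVneq r 0.
    by exists 0, 0, e; split; rewrite ?mul0r ?scale0r ?subr0.
  have alga : algebraic a by have := alg_a 1; rewrite mul1r.
  have [al [q [k0 ak]]] := algebraic_eigenvector alga e0.
  exists al, (r *: f), (e - al *: f); split.
  - by rewrite -scalerAl fE.
  - by rewrite mulrBl ea -scalerAl fE.
  - move=> _; exists (horner_alg a q * e); split=> //.
    by rewrite mulrA -(horner_alg_comm q (esym ea)) -mulrA ee.
exists al; apply/eqP; rewrite -subr_eq0; apply: contraT => h0; exfalso.
have [h hE] : exists h, h = a * e - al *: e by exists (a * e - al *: e).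
rewrite -hE in gE h0.
have he : h * e = h by rewrite hE mulrBl -mulrA ee -scalerAl ee.
have hk k : e * k = 0 -> h * k = 0 by move=> ek; rewrite -he -mulrA ek mulr0.
have [x] := semiprim h0; rewrite -(scale1r 1) => xh.
have xhalg : algebraic (x * h) by rewrite -gE mulrA.
have [l l0 xhl] := spectrum_eigenvalue xhalg xh; rewrite scale1r in xhl.
pose l' := e * l.
have hl : h * l' = h * l by rewrite mulrA he.
have l'0 : l' != 0.
  apply: contra l0 => /eqP l'0.
  by rewrite -xhl -mulrA -hl l'0 !mulr0.
have el' : e * l' = l' by rewrite mulrA ee.
have [ss ssP] := algebraic_spectrum_finite (alg_a y).
have [t t0 tss] := fresh_scalar ss.
pose X := y * (1 - e) + d + (t - r) *: (e * x * g).
have XE : X * a = c * (1 - e) + r *: e + (t - r) *: (e * (x * h)).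
  rewrite !mulrDl da -scalerAl -!mulrA gE.
  suff -> : (1 - e) * a = a * (1 - e) by [].
  by rewrite mulrBl mulrBr mul1r mulr1 ea.
(* Off the block X a acts as c; on the block, as r plus a multiple of x h. *)
have Xk k : e * k = 0 -> X * a * k = c * k.
  move=> ek; rewrite XE !mulrDl -!scalerAl -!mulrA ek hk // !mulr0.
  by rewrite !scaler0 !addr0 mulrBl mul1r ek subr0.
have Xek k : e * k = k -> X * a * k = r *: k + (t - r) *: (e * (x * (h * k))).
  move=> ek; have ek0' : (1 - e) * k = 0 by rewrite mulrBl mul1r ek subrr.
  by rewrite XE !mulrDl -!scalerAl -!mulrA ek ek0' !mulr0 add0r.
move/negP: tss; apply; apply: ssP; apply: (maxa (x := X)) => // [r' r'0 r's|].
  have [E|r'r] := eqVneq r' r.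
    rewrite E in r'0 *; have [k [k0 ek ak]] := rk r'0.
    apply: (eigenvalue_spectrum k0); rewrite Xek //.
    by rewrite hE mulrBl -mulrA ek -scalerAl ek ak subrr !mulr0 scaler0 addr0.
  have [k k0 ck] := spectrum_eigenvalue (alg_a y) r's.
  by apply: (eigenvalue_spectrum k0); rewrite Xk // (ek0 r').
apply: (eigenvalue_spectrum l'0); rewrite Xek // hl [x * _]mulrA xhl -/l'.
by rewrite -scalerDl addrC subrK.
Qed.

(** Here c is killed by P, the product of the X - r; Bezout for the coprime
    factors of P at each root r gives an idempotent E(c) with 1 - E divisible by
    the part of P at r.  Hence P divides the product of all the 1 - E, which is
    the form in which completeness of the blocks is used. *)
Lemma scalar_blocks : exists es : seq (K * A),
  (forall ae, ae \in es ->
     ae.2 * a = ae.1 *: ae.2 /\ a * ae.2 = ae.1 *: ae.2) /\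
  \prod_(ae <- es) (1 - ae.2) = 0.
Proof.
(* The factor 'X makes 0 a root, so that E(0) = 0 for the other roots and E(c)
   is a multiple of c. *)
have [p0 p00 p0c] := alg_a y; pose p := 'X * p0.
have pN0 : p != 0 by rewrite mulf_neq0 // polyX_eq0.
have pc : horner_alg c p = 0 by rewrite rmorphM /= p0c mulr0.
have [rs prs] := closed_field_poly_normal p.
have lp : lead_coef p != 0 by rewrite lead_coef_eq0.
pose P := \prod_(r <- rs) ('X - r%:P).
have Pc : horner_alg c P = 0.
  by apply: (scalerI lp); rewrite -horner_algZ -prs pc scaler0.
have P0 : root P 0.
  have : root p 0 by rewrite rootM rootX eqxx.
  by rewrite prs rootZ.
have PN0 : P != 0 by rewrite monic_neq0 // monic_prod_XsubC.
have cP q : P %| q -> horner_alg c q = 0.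
  by move=> /dvdpP [d ->]; rewrite rmorphM /= Pc mulr0.
have ca : c * a = a * c by rewrite /c mulrA -ya.
have rP r : exists E : {poly K} * K, r \in rs ->
   ('X - r%:P) ^+ count_mem r rs %| 1 - E.1 /\
   a * horner_alg c E.1 = E.2 *: horner_alg c E.1.
  case: (boolP (r \in rs)) => [rrs|_]; last by exists (0, 0).
  have [m [q /implyP/(_ PN0) qr PE]] := multiplicity_XsubC P r.
  have mE : m = count_mem r rs.
    by rewrite -mu_prod_XsubC -/P PE mupMr // mup_XsubCX eqxx.
  have cop : coprimep (('X - r%:P) ^+ m) q.
    by rewrite coprimep_expl // coprimep_sym coprimep_XsubC.
  have /Bezout_eq1_coprimepP [[u v] /= uv] := cop.
  have ca' := horner_alg_comm (v * q) ca.
  have vqE : 1 - v * q = u * ('X - r%:P) ^+ m by rewrite -uv addrK.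
  have [| r' k r'0 r'r ck | r0 | al alE] :=
    @block_scalar (horner_alg c (v * q)) r _ ca'.
  - apply/eqP; rewrite -subr_eq0 -rmorphM -rmorphB; apply/eqP/cP.
    rewrite -{3}[v * q]mulr1 -mulrBr -opprB vqE mulrN dvdpNr PE.
    by rewrite mulrACA; apply: dvdp_mull.
  - rewrite (horner_alg_eigen _ ck).
    have := horner_alg_eigen P ck; rewrite Pc mul0r => /esym/eqP.
    rewrite scaler_eq0 => /orP [|/eqP ->]; last by rewrite scaler0.
    rewrite PE -/(root _ _) rootM => /orP [/rootP qr'|].
      by rewrite hornerM qr' mulr0 scale0r.
    by rewrite /root horner_exp hornerXsubC expf_eq0 subr_eq0 (negPf r'r) andbF.
  - have /factor_theorem [d qd] : root q 0.
      move: P0; rewrite PE rootM => /orP [//|]; rewrite /root horner_exp.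
      by rewrite expf_eq0 !hornerE oppr_eq0 (negPf r0) andbF.
    exists (horner_alg c (v * d) * y).
    rewrite -mulrA -/c qd polyC0 subr0 (mulrA v d).
    by rewrite [in RHS]rmorphM /= horner_algX.
  - by exists (v * q, al) => _; split; rewrite //= -mE vqE dvdp_mull.
have [E EP] := choice rP.
exists [seq ((E r).2, horner_alg c (E r).1) | r <- undup rs]; split.
  move=> q /mapP [r]; rewrite mem_undup => /EP [_ aE] -> /=.
  by rewrite (horner_alg_comm _ ca).
rewrite big_map /= (eq_bigr (fun r => horner_alg c (1 - (E r).1)));
  last first => [r _|].
  by rewrite rmorphB rmorph1.
rewrite -rmorph_prod; apply: cP; rewrite /P -prodr_undup_exp_count.
rewrite big_seq [X in _ %| X]big_seq.
apply: (big_ind2 (fun p q => p %| q)) => [|p1 q1 p2 q2|r].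
- exact: dvdpp.
- exact: dvdp_mul.
- by rewrite mem_undup => /EP [].
Qed.

End Block.
End Semiprimitive.

(** * Sequences that decay faster than every geometric sequence *)

Section Decay.
Variable R : realType.
Implicit Types (x D e : R) (f : nat -> R).

Lemma expr2_unbounded x : exists n, x <= 2 ^+ n.
Proof.
exists (Num.bound `|x|); apply/ltW/(lt_trans (y := (Num.bound `|x|)%:R)).
  by apply: le_lt_trans (ler_norm x) _; apply: archi_boundP.
by rewrite -natrX ltr_nat ltn_expl.
Qed.

Lemma le0_of_half_pow x D : (forall n, x <= D * 2^-1 ^+ n) -> x <= 0.
Proof.
move=> xD; rewrite leNgt; apply/negP => x0.
have [n] := expr2_unbounded ((D + 1) / x).
rewrite ler_pdivrMr // => h; have := xD n.
rewrite exprVn ler_pdivlMr ?exprn_gt0 // mulrC => /(le_trans h).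
by rewrite gerDl ler10.
Qed.

(** For nonnegative f this says that f n ^ (1/n) tends to 0. *)
Definition superexp_small f : Prop :=
  forall e, 0 < e -> exists D, forall n, f n <= D * e ^+ n.

Lemma superexp_small_near f :
  (forall e, 0 < e -> exists N, forall n, (N <= n)%N -> f n <= e ^+ n) ->
  (forall n, 0 <= f n) -> superexp_small f.
Proof.
move=> fN f0 e e0; have [N NP] := fN e e0.
exists (1 + \sum_(i < N) f i / e ^+ i) => n.
have s0 i : 0 <= f i / e ^+ i by rewrite divr_ge0 ?exprn_ge0 // ltW //.
have [/NP h|nN] := leqP N n.
  apply: le_trans h _; rewrite ler_peMl ?lerDl ?sumr_ge0 // exprn_ge0 // ltW //.
rewrite -ler_pdivrMr ?exprn_gt0 // (bigD1 (Ordinal nN)) //= addrCA lerDl.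
by rewrite addr_ge0 // sumr_ge0.
Qed.

Lemma limn_esup_root_ge0 f :
  (0 <= limn_esup (fun n => (f n `^ n%:R^-1)%:E))%E.
Proof.
apply/ereal_infP => _ [V [N _ NV] <-].
apply: le_ereal_sup_tmp; exists (f N `^ N%:R^-1)%:E.
  by exists N => //; apply: NV => /=.
by rewrite lee_fin powR_ge0.
Qed.

(** The root test: f n ^ (1/n) has limsup at most 0 exactly when f n is
    eventually below e^n for every e > 0, and finitely many terms are absorbed
    by the constant D. *)
Lemma limn_esup_root_le0 f : (forall n, 0 <= f n) ->
  (limn_esup (fun n => (f n `^ n%:R^-1)%:E) <= 0)%E <-> superexp_small f.
Proof.
move=> f0; split=> [f_le|fs].
  apply: superexp_small_near => // e e0.
  have /ereal_inf_lt [_ [V [N _ NV] <-] sup_lt] :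
      (limn_esup (fun n => (f n `^ n%:R^-1)%:E) < e%:E)%E.
    by apply: le_lt_trans f_le _; rewrite lte_fin.
  exists N.+1 => n nN; have n0 : (n != 0)%N by case: n nN.
  have -> : f n = (f n `^ n%:R^-1) ^+ n.
    by rewrite -powR_mulrn ?powR_ge0 // -powRrM mulVf ?pnatr_eq0 ?powRr1.
  apply: lerXn2r; rewrite ?nnegrE ?powR_ge0 ?(ltW e0) //.
  rewrite -lee_fin; apply/ltW/(le_lt_trans _ sup_lt)/le_ereal_sup_tmp.
  exists (f n `^ n%:R^-1)%:E => //; exists n => //.
  by apply: NV; exact: ltnW.
apply/lee_addgt0Pr => d d0; rewrite add0e.
(* Halving the rate leaves a factor 2^n that beats the constant D. *)
have [D fD] := fs (d / 2) ltac:(by rewrite divr_gt0).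
have [N DN] := expr2_unbounded D.
apply: ge_ereal_inf; eexists.
  by exists [set n | (N.+1 <= n)%N] => //; exists N.+1.
apply/ereal_supP => _ [n /= Nn <-]; rewrite lee_fin.
have n0 : (n != 0)%N by case: n Nn.
have -> : d = (d ^+ n) `^ n%:R^-1.
  by rewrite -powR_mulrn ?(ltW d0) // -powRrM mulfV ?pnatr_eq0 ?powRr1 // ltW.
apply: ge0_ler_powR; rewrite ?invr_ge0 ?nnegrE ?exprn_ge0 // ?(ltW d0) //.
apply: le_trans (fD n) _.
rewrite expr_div_n mulrCA ler_piMr ?exprn_ge0 ?(ltW d0) //.
rewrite ler_pdivrMr ?exprn_gt0 // mul1r; apply: le_trans DN _.
by rewrite ler_eXn2l ?ltr1n // ltnW.
Qed.

End Decay.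

(** * Real-valued norms *)

Section RealNorm.
Variables (R : realType) (A : banachAlgType R[i]).
Implicit Types (a b x y : A) (z w : R[i]).

Lemma rnormE x : `|x| = (rnorm x)%:C.
Proof. by rewrite /rnorm RRe_real // normr_real. Qed.

Lemma normcE z : `|z| = (normc z)%:C.
Proof. by []. Qed.

Lemma normc_ge0 z : 0 <= normc z.
Proof. by rewrite -lecR -normcE normr_ge0. Qed.

Lemma normcD z w : normc (z + w) <= normc z + normc w.
Proof. by rewrite -lecR rmorphD /= -!normcE ler_normD. Qed.

Lemma normc_real (r : R) : normc r%:C = `|r|.
Proof. by rewrite /= expr0n addr0 sqrtr_sqr. Qed.

Lemma normc_le_ReIm (r t : R) : normc (r +i* t) <= `|r| + `|t|.
Proof.
have -> : r +i* t = r%:C + 'i%C * t%:C by rewrite [LHS]complexE.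
apply: le_trans (normcD _ _) _.
by rewrite normcM !normc_real /= expr0n expr1n add0r sqrtr1 mul1r.
Qed.

Lemma normc_ge_ReIm (r t : R) :
  `|r| <= normc (r +i* t) /\ `|t| <= normc (r +i* t).
Proof.
by split; rewrite -sqrtr_sqr ler_wsqrtr //= ?lerDl ?lerDr sqr_ge0.
Qed.

Lemma rnorm_ge0 x : 0 <= rnorm x.
Proof. by rewrite -lecR -rnormE normr_ge0. Qed.

Lemma rnorm_eq0 x : rnorm x = 0 -> x = 0.
Proof. by move=> x0; apply: normr0_eq0; rewrite rnormE x0. Qed.

Lemma rnormD x y : rnorm (x + y) <= rnorm x + rnorm y.
Proof. by rewrite -lecR rmorphD /= -!rnormE ler_normD. Qed.

Lemma rnormM x y : rnorm (x * y) <= rnorm x * rnorm y.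
Proof. by rewrite -lecR rmorphM /= -!rnormE ler_normM. Qed.

Lemma rnormZ z x : rnorm (z *: x) = normc z * rnorm x.
Proof. by apply: complexI; rewrite rmorphM /= -normcE -!rnormE normrZ. Qed.

Lemma normcX z n : normc (z ^+ n) = normc z ^+ n.
Proof. by apply: complexI; rewrite rmorphXn /= -!normcE normrX. Qed.

Lemma rnormN x : rnorm (- x) = rnorm x.
Proof. by rewrite /rnorm normrN. Qed.

Lemma rnormB x y : rnorm (x - y) <= rnorm x + rnorm y.
Proof. by rewrite -(rnormN y) rnormD. Qed.

End RealNorm.

(** * Decaying powers imply quasinilpotence *)

Section Neumann.
Variables (R : realType) (A : banachAlgType R[i]).
Implicit Types (a b x y : A) (z w : R[i]).

(** The factor 1 - 2^-j is what makes the induction on j close. *)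
Lemma rnorm_sum_tail (u : nat -> A) (D : R) m j :
  (forall n, rnorm (u n) <= D * 2^-1 ^+ n) ->
  rnorm (\sum_(m <= k < m + j) u k)
    <= 2 * D * 2^-1 ^+ m * (1 - 2^-1 ^+ j).
Proof.
move=> uD; elim: j => [|j IH].
  by rewrite addn0 big_geq // expr0 subrr mulr0 /rnorm normr0.
rewrite addnS big_nat_recr ?leq_addr //=; apply: le_trans (rnormD _ _) _.
have := uD (m + j)%N; rewrite exprD exprS; move: IH; lra.
Qed.

Lemma cauchy_series_cvg (u : nat -> A) :
  superexp_small (fun n => rnorm (u n)) ->
  exists l : A, forall e, 0 < e -> exists n0, forall n, (n0 <= n)%N ->
    rnorm (l - \sum_(0 <= k < n) u k) < e.
Proof.
move=> /(_ 2^-1) [|D uD]; first by rewrite invr_gt0.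
pose s n := \sum_(0 <= k < n) u k.
have : cvg (s @ \oo).
  apply/cauchy_cvgP/cauchy_exP => e e0.
  have ee : e = (complex.Re e)%:C by rewrite RRe_real // ger0_real // ltW.
  have re0 : 0 < complex.Re e by move: e0; rewrite {1}ee ltcR.
  have [n nP] : exists n, 2 * D * 2^-1 ^+ n < complex.Re e.
    apply: contrapT => /forallNP nP.
    have : complex.Re e <= 0.
      apply: (@le0_of_half_pow _ _ (2 * D)) => n.
      by rewrite leNgt; apply/negP/nP.
    by rewrite leNgt re0.
  exists (s n); exists n => // k /= nk.
  rewrite -ball_normE /= distrC rnormE ee ltcR /s.
  rewrite (big_cat_nat (leq0n n) nk) /= addrAC subrr add0r -(subnKC nk).
  apply: le_lt_trans (rnorm_sum_tail _ _ uD) (le_lt_trans _ nP).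
  rewrite ler_piMr ?gerBl ?exprn_ge0 ?invr_ge0 //.
  rewrite mulr_ge0 ?exprn_ge0 ?invr_ge0 // mulr_ge0 //.
  by apply: le_trans (rnorm_ge0 (u 0%N)) _; have := uD 0%N; rewrite expr0 mulr1.
move=> /cvg_ex [l sl]; exists l => e e0.
have /cvgrPdist_lt /(_ e%:C) := sl.
rewrite ltcR => /(_ e0) [n0 _ n0P]; exists n0 => n /n0P /=.
by rewrite rnormE ltcR.
Qed.

Lemma rnorm_small_eq0 x : (forall e : R, 0 < e -> rnorm x <= e) -> x = 0.
Proof.
move=> xe; apply/rnorm_eq0/eqP; rewrite eq_le rnorm_ge0 andbT.
by apply/ler_addgt0Pr => e e0; rewrite add0r xe.
Qed.

Lemma superexp_small_lim (f : nat -> R) (e : R) :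
  superexp_small f -> 0 < e -> exists n0, forall n, (n0 <= n)%N -> f n <= e.
Proof.
move=> /(_ 2^-1) [|D fD e0]; first by rewrite invr_gt0.
have [n0 Dn0] := expr2_unbounded (D / e); exists n0 => n n0n.
apply: le_trans (fD n) _; rewrite exprVn ler_pdivrMr ?exprn_gt0 //.
rewrite mulrC -ler_pdivrMr //; apply: le_trans Dn0 _.
by rewrite ler_eXn2l ?ltr1n.
Qed.

Lemma superexp_small_subr_unit y :
  superexp_small (fun n => rnorm (y ^+ n)) -> 1 - y \is a GRing.unit.
Proof.
move=> ys; have [l lP] := cauchy_series_cvg ys.
pose s n := \sum_(0 <= k < n) y ^+ k.
have sl n : (1 - y) * s n = 1 - y ^+ n.
  elim: n => [|n IH]; first by rewrite /s big_geq // mulr0 expr0 subrr.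
  rewrite /s big_nat_recr //= mulrDr -/(s n) IH mulrBl mul1r -exprS.
  by rewrite addrA subrK.
have sr n : s n * (1 - y) = 1 - y ^+ n.
  elim: n => [|n IH]; first by rewrite /s big_geq // mul0r expr0 subrr.
  rewrite /s big_nat_recr //= mulrDl -/(s n) IH mulrBr mulr1 -exprSr.
  by rewrite addrA subrK.
have close e : 0 < e -> exists n,
    rnorm (1 - y) * rnorm (l - s n) + rnorm (y ^+ n) <= e.
  move=> e0; have c0 : 0 < rnorm (1 - y) + 1 by rewrite ltr_wpDl ?rnorm_ge0.
  have [|n0 n0P] := lP (e / 2 / (rnorm (1 - y) + 1)).
    by rewrite divr_gt0 ?divr_gt0.
  have [|n1 n1P] := superexp_small_lim (e := e / 2) ys.
    by rewrite divr_gt0.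
  exists (maxn n0 n1); rewrite [leRHS](splitr e) lerD ?n1P ?leq_maxr //.
  have := ltW (n0P (maxn n0 n1) (leq_maxl _ _)).
  rewrite ler_pdivlMr // mulrDr mulr1 mulrC; apply: le_trans.
  by rewrite lerDl rnorm_ge0.
apply/unitrP; exists l; split; apply/eqP; rewrite -subr_eq0; apply/eqP.
  apply: rnorm_small_eq0 => e /close [n]; apply: le_trans.
  have -> : l * (1 - y) - 1 = (l - s n) * (1 - y) - y ^+ n.
    by rewrite mulrBl sr opprB addrA addrAC addrK.
  by apply: le_trans (rnormB _ _) _; rewrite lerD2r [leRHS]mulrC rnormM.
apply: rnorm_small_eq0 => e /close [n]; apply: le_trans.
have -> : (1 - y) * l - 1 = (1 - y) * (l - s n) - y ^+ n.
  by rewrite mulrBr sl opprB addrA addrAC addrK.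
by apply: le_trans (rnormB _ _) _; rewrite lerD2r rnormM.
Qed.

(** Off 0 invertibility comes from the Neumann series; 0 is in the spectrum
    because an invertible x satisfies ||1|| <= ||x^-1||^n ||x^n|| for all n. *)
Lemma superexp_small_quasinilpotent x :
  superexp_small (fun n => rnorm (x ^+ n)) -> quasinilpotent x.
Proof.
move=> xs; apply/seteqP; split => [z|_ ->]; rewrite /spectrum /=.
  have [->//|z0] := eqVneq z 0; move=> /negP []; apply/unitrP.
  have n0 : 0 < normc z by rewrite -ltcR -normcE normr_gt0.
  have : 1 - z^-1 *: x \is a GRing.unit.
    apply: superexp_small_subr_unit => e e0.
    have [|D xD] := xs (e * normc z); first exact: mulr_gt0.
    exists D => n; rewrite exprZn rnormZ normcX.
    rewrite -(ler_pM2l (x := normc z ^+ n)) ?exprn_gt0 // mulrA -exprMn.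
    rewrite -normcM mulfV // normc1 expr1n mul1r.
    by apply: le_trans (xD n) _; rewrite exprMn mulrA mulrC.
  move=> /unitrP [w [wl wr]]; exists (z^-1 *: w).
  have -> : z%:A - x = z *: (1 - z^-1 *: x).
    by rewrite scalerBr scalerA mulfV // scale1r.
  by rewrite -!scalerAl -!scalerAr !scalerA wl wr mulVf ?mulfV // scale1r.
rewrite scale0r sub0r unitrN; apply/negP => ux.
suff /rnorm_eq0/eqP : rnorm (1 : A) = 0 by apply/negP/oner_neq0.
apply/eqP; rewrite eq_le rnorm_ge0 andbT.
pose c := rnorm x^-1 + 1; have c0 : 0 < c by rewrite ltr_wpDl ?rnorm_ge0.
have [|D xD] := xs (2^-1 / c); first by rewrite divr_gt0 ?invr_gt0.
apply: (@le0_of_half_pow _ _ D) => n.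
have : rnorm (1 : A) <= c ^+ n * rnorm (x ^+ n).
  elim: n => [|n IH]; first by rewrite !expr0 mul1r.
  apply: le_trans IH _; rewrite exprSr -mulrA ler_pM2l ?exprn_gt0 //.
  rewrite -{1}[x ^+ n](mulKr ux) -exprS; apply: le_trans (rnormM _ _) _.
  by rewrite ler_wpM2r ?rnorm_ge0 // lerDl.
move=> /le_trans; apply; rewrite mulrC -ler_pdivlMr ?exprn_gt0 //.
by rewrite -mulrA -expr_div_n.
Qed.

End Neumann.

(** * Quasinilpotence implies decaying powers *)

Section DifferenceOfSquares.
Variables (K : numFieldType) (A : unitAlgType K) (p : A).
Hypotheses (up : 1 - p \is a GRing.unit) (un : 1 + p \is a GRing.unit).

Let sqrN : (1 + p) * (1 - p) = 1 - p ^+ 2.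
Proof. by rewrite mulrDl !mulrBr !mul1r mulr1 addrA subrK expr2. Qed.

Let sqNr : (1 - p) * (1 + p) = 1 - p ^+ 2.
Proof. by rewrite mulrBl !mulrDr !mul1r mulr1 opprD addrA addrK expr2. Qed.

Lemma sqr_sub_unit : 1 - p ^+ 2 \is a GRing.unit.
Proof. by rewrite -sqrN unitrMl. Qed.

Lemma invr_sub_sqr :
  (1 - p ^+ 2)^-1 = 2^-1 *: ((1 - p)^-1 + (1 + p)^-1).
Proof.
apply: (mulrI sqr_sub_unit); rewrite mulrV ?sqr_sub_unit // -scalerAr mulrDr.
rewrite -{1}sqrN -sqNr mulrK // mulrK // addrACA subrr addr0.
have -> : 1 + 1 = (2%:R : K) *: (1 : A) by rewrite scaler_nat mulr2n.
by rewrite scalerA mulVf ?pnatr_eq0 // scale1r.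
Qed.

End DifferenceOfSquares.

Section Resolvent.
Variables (R : realType) (A : banachAlgType R[i]) (x : A).
Implicit Types (z w : R[i]).

Hypothesis ux : forall z, 1 - z *: x \is a GRing.unit.

Let res z := (1 - z *: x)^-1.

Lemma resolvent_sub z w : res z - res w = (z - w) *: (res z * x * res w).
Proof.
have -> : res z - res w = res z * ((1 - w *: x) - (1 - z *: x)) * res w.
  by rewrite mulrBr mulVr // mulrBl mul1r -mulrA mulrV // mulr1.
have -> : (1 - w *: x) - (1 - z *: x) = (z - w) *: x.
  by rewrite opprB addrC addrA subrK scalerBl.
by rewrite -scalerAr -scalerAl.
Qed.

Lemma rnorm_resolvent_sub z w :
  rnorm (res z - res w) <=
    normc (z - w) * (rnorm (res z) * rnorm x * rnorm (res w)).
Proof.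
rewrite resolvent_sub rnormZ ler_wpM2l ?normc_ge0 //.
apply: le_trans (rnormM _ _) _.
by rewrite ler_wpM2r ?rnorm_ge0 // rnormM.
Qed.

(** The resolvent identity bounds ||R(z)|| by ||R(w)|| plus a term that is at
    most ||R(z)|| / 2 for z close to w, and can be absorbed. *)
Lemma resolvent_locally_bounded w : exists2 d : R, 0 < d &
  forall z, normc (z - w) <= d -> rnorm (res z) <= 2 * rnorm (res w).
Proof.
pose q := rnorm x * rnorm (res w).
have q0 : 0 <= q by rewrite mulr_ge0 ?rnorm_ge0.
exists (2^-1 / (q + 1)); first by rewrite divr_gt0 ?invr_gt0 ?ltr_wpDl.
move=> z; rewrite ler_pdivlMr ?ltr_wpDl // => zw.
have := rnormD (res z - res w) (res w); rewrite subrK.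
have := rnorm_resolvent_sub z w; rewrite -mulrA -/q.
have := rnorm_ge0 (res z); have := normc_ge0 (z - w).
move: (rnorm (res z)) (rnorm (res w)) (rnorm (res z - res w)) (normc (z - w))
  zw.
by move=> nz nw t d h d0 nz0 h1 h2; nra.
Qed.

(** Compactness is applied to a square in R x R containing the disc. *)
Lemma resolvent_bounded (M : R) : exists2 B : R, 0 < B &
  forall z, normc z <= M -> rnorm (res z) <= B.
Proof.
have cK : compact (`[- M, M] `*` `[- M, M] : set (R * R)).
  by apply: compact_setX; apply: segment_compact.
have /compact_near_coveringP/(_ nat \oo
  (fun n p => rnorm (res (p.1 +i* p.2)) <= n%:R) _) := cK.
case=> [p _|n _ /(_ n (leqnn n)) nP].
  have [d d0 dP] := resolvent_locally_bounded (p.1 +i* p.2).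
  pose n0 := Num.bound (2 * rnorm (res (p.1 +i* p.2))).
  exists (ball p (d / 2), [set n | (n0 <= n)%N]).
    by split; [apply: nbhsx_ballx; rewrite divr_gt0 | exists n0].
  move=> [[r t] n] /= [[/= h1 h2] n0n].
  apply: (@le_trans _ _ (2 * rnorm (res (p.1 +i* p.2)))).
    apply: dP; rewrite -[(r +i* t) - _]/((r - p.1) +i* (t - p.2)).
    apply: le_trans (normc_le_ReIm _ _) _; rewrite [leRHS](splitr d).
    by rewrite lerD // distrC ltW.
  apply: (@le_trans _ _ n0%:R); last by rewrite ler_nat.
  by apply/ltW/archi_boundP; rewrite mulr_ge0 ?rnorm_ge0.
exists (n%:R + 1); first by rewrite ltr_wpDl.
move=> [r t] rtM; apply: (@le_trans _ _ n%:R); last by rewrite lerDl.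
have [rM tM] := normc_ge_ReIm r t.
apply: (nP (r, t)); split; rewrite /= in_itv /= -ler_norml.
- exact: le_trans rM rtM.
- exact: le_trans tM rtM.
Qed.

(** Since 1 - p^2 = (1 - p)(1 + p), the inverse of 1 - (z x)^(2n) is the mean
    of the inverses of 1 - (z x)^n and 1 + (z x)^n = 1 - (u z x)^n, where
    u^n = -1.  As |u| = 1, the disc is preserved and the constants B and L do
    not deteriorate with m. *)
Lemma dyadic_averaging (M B L : R) :
  (forall z, normc z <= M -> rnorm (res z) <= B) ->
  (forall z w, normc z <= M -> normc w <= M ->
     rnorm (res z - res w) <= L * normc (z - w)) ->
  forall m z, let F z := (1 - (z *: x) ^+ (2 ^ m))^-1 in
  [/\ 1 - (z *: x) ^+ (2 ^ m) \is a GRing.unit,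
      normc z <= M -> rnorm (F z) <= B &
      forall w, normc z <= M -> normc w <= M ->
        rnorm (F z - F w) <= L * normc (z - w)].
Proof.
move=> resB resL; elim=> [|m IH] z F.
  by split=> [|/resB|w zM]; rewrite /F expr1; [exact: ux | | exact: resL].
set n := (2 ^ m)%N in IH; have n0 : (0 < n)%N by rewrite expn_gt0.
pose u : R[i] := n.-root (-1); have un : u ^+ n = -1 by rewrite rootCK.
have nu : normc u = 1.
  apply: complexI; rewrite -normcE; apply/eqP.
  by rewrite -(pexpr_eq1 n0) ?normr_ge0 // -normrX un normrN1.
pose G w := (1 - (w *: x) ^+ n)^-1.
have nuw w : normc (u * w) = normc w by rewrite normcM nu mul1r.
have twist w : 1 - ((u * w) *: x) ^+ n = 1 + (w *: x) ^+ n.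
  by rewrite -scalerA exprZn un scaleN1r opprK.
have split_sq w : 1 - (w *: x) ^+ (2 ^ m.+1) = 1 - ((w *: x) ^+ n) ^+ 2.
  by rewrite expnS mulnC exprM.
have IHu w : 1 + (w *: x) ^+ n \is a GRing.unit.
  by rewrite -twist; case: (IH (u * w)).
have IHv w : 1 - (w *: x) ^+ n \is a GRing.unit by case: (IH w).
have FE w : F w = 2^-1 *: (G w + G (u * w)).
  by rewrite /F split_sq invr_sub_sqr // /G twist.
have le_half (g h : A) (e : R) : rnorm g <= e -> rnorm h <= e ->
    rnorm (2^-1 *: (g + h)) <= e.
  have -> : (2^-1 : R[i]) = (2^-1)%:C by rewrite fmorphV rmorph_nat.
  move=> ge he.
  rewrite rnormZ normc_real ger0_norm ?invr_ge0 // mulrC ler_pdivrMr //.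
  by rewrite mulr_natr; apply: le_trans (rnormD _ _) (lerD ge he).
split=> [|zM|w zM wM].
- by rewrite split_sq sqr_sub_unit.
- have [_ B1 _] := IH z; have [_ B2 _] := IH (u * z).
  by rewrite FE; apply: le_half; [apply: B1 | apply: B2; rewrite nuw].
- have [_ _ L1] := IH z; have [_ _ L2] := IH (u * z).
  have -> : F z - F w = 2^-1 *: ((G z - G w) + (G (u * z) - G (u * w))).
    by rewrite !FE -scalerBr opprD addrACA.
  apply: le_half; first exact: L1.
  by rewrite -(nuw (z - w)) mulrBr; apply: L2; rewrite nuw.
Qed.

(** If (z x)^(2^m) is small then F(z) is close to 1, hence F(w) is close to 1
    by the Lipschitz bound, hence (w x)^(2^m) = 1 - F(w)^-1 has norm at most 1. *)
Lemma dyadic_step (M B L : R) :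
  (forall z, normc z <= M -> rnorm (res z) <= B) ->
  (forall z w, normc z <= M -> normc w <= M ->
     rnorm (res z - res w) <= L * normc (z - w)) ->
  forall m z w, normc z <= M -> normc w <= M ->
    B * rnorm ((z *: x) ^+ (2 ^ m)) <= 4^-1 -> L * normc (w - z) <= 4^-1 ->
    rnorm ((w *: x) ^+ (2 ^ m)) <= 1.
Proof.
move=> resB resL m z w zM wM Bz Lwz.
have [uz Fz _] := dyadic_averaging resB resL m z.
have [uw _ /(_ _ wM zM) FwB] := dyadic_averaging resB resL m w.
move: uz Fz uw FwB Bz => /=; set s := (z *: x) ^+ _; set t := (w *: x) ^+ _.
set g := (1 - s)^-1; set h := (1 - t)^-1 => us Fz ut Fw Bs.
have gE : g - 1 = g * s.
  by rewrite -[X in _ - X](mulVr us) mulrBr mulr1 opprB addrC subrK.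
have hE : t = (h - 1) - (h - 1) * t.
  rewrite -{1}[h - 1]mulr1 -mulrBr mulrBl mulVr // mul1r.
  by rewrite opprB addrC subrK.
have g1 : rnorm (g - 1) <= 4^-1.
  rewrite gE; apply: le_trans (rnormM _ _) (le_trans _ Bs).
  by rewrite ler_wpM2r ?rnorm_ge0 // Fz.
have h1 : rnorm (h - 1) <= 2^-1.
  rewrite -(subrK g h) -addrA; apply: le_trans (rnormD _ _) _.
  by have := le_trans Fw Lwz; lra.
have := rnormB (h - 1) ((h - 1) * t); rewrite -hE.
have := rnormM (h - 1) t; have := rnorm_ge0 t; have := rnorm_ge0 (h - 1).
move: (rnorm (h - 1)) (rnorm t) (rnorm _) h1 => p q r h1 p0 q0 rp qr; nra.
Qed.

(** Radii are the multiples of d = M / K.  If t^(2^m) ||x^(2^m)|| tends to 0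
    at t = k d, it is at most 1 for large m at t = (k + 2) d, and therefore
    tends to 0 at t = (k + 1) d, by the factor ((k + 1) / (k + 2))^(2^m).  The
    step d depends only on the disc, so the induction reaches r. *)
Lemma power_small (r : R) : 0 < r ->
  exists2 n, (0 < n)%N & r ^+ n * rnorm (x ^+ n) <= 1.
Proof.
move=> r0; pose M := 3 * r; have M0 : 0 < M by rewrite mulr_gt0.
have [B B0 resB] := resolvent_bounded M.
pose L := B * rnorm x * B.
have L0 : 0 <= L by rewrite !mulr_ge0 ?rnorm_ge0 // ltW.
have resL z w : normc z <= M -> normc w <= M ->
    rnorm (res z - res w) <= L * normc (z - w).
  move=> zM wM; apply: le_trans (rnorm_resolvent_sub z w) _.
  rewrite mulrC ler_wpM2r ?normc_ge0 // /L -!mulrA.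
  apply: ler_pM; rewrite ?mulr_ge0 ?rnorm_ge0 ?resB //.
  by rewrite ler_wpM2l ?rnorm_ge0 ?resB.
(* K is a power of 2 plus 2 so that the last index K - 2 gives a radius at least
   M / 3 = r. *)
have [K0 K0P] := expr2_unbounded (8 * M * L); pose K := (2 ^ K0).+2.
pose d := M / K%:R; have d0 : 0 < d by rewrite divr_gt0.
have td (t : nat) : 0 <= t%:R * d by apply: mulr_ge0 (ler0n _ _) (ltW d0).
have Ld : L * (2 * d) <= 4^-1.
  rewrite /d mulrCA mulrA mulrA ler_pdivrMr //.
  have : 8 * M * L <= K%:R.
    by apply: le_trans K0P _; rewrite -natrX ler_nat; exact: leqW (leqnSn _).
  by lra.
have nz (t : R) n : 0 <= t ->
    rnorm ((t%:C *: x) ^+ n) = t ^+ n * rnorm (x ^+ n).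
  by move=> t0; rewrite exprZn rnormZ normcX normc_real ger0_norm.
have small k : (k.+1 < K)%N -> forall e, 0 < e ->
    exists m0, forall m, (m0 <= m)%N ->
    (k%:R * d) ^+ (2 ^ m) * rnorm (x ^+ (2 ^ m)) <= e.
  elim: k => [_ e e0|k IH kK e e0].
    by exists 0%N => m _; rewrite mul0r expr0n eqn0Ngt expn_gt0 /= mul0r ltW.
  have [|m0 m0P] := IH (ltnW kK) (4^-1 / B); first by rewrite divr_gt0.
  pose q : R := k.+1%:R / k.+2%:R.
  have q1 : `|q| < 1.
    by rewrite ger0_norm ?divr_ge0 // ltr_pdivrMr // mul1r ltr_nat.
  have /cvgrPdist_le /(_ _ e0) [m1 _ m1P] := cvg_expr q1.
  exists (maxn m0 m1) => m; rewrite geq_max => /andP [m0m m1m].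
  have pw : (k.+2%:R * d) ^+ (2 ^ m) * rnorm (x ^+ (2 ^ m)) <= 1.
    have kd t : (t <= K)%N -> normc (t%:R * d)%:C <= M.
      move=> tK; rewrite normc_real ger0_norm ?td //.
      by rewrite /d mulrCA ler_piMr ?(ltW M0) // ler_pdivrMr // mul1r ler_nat.
    rewrite -nz ?td //.
    apply: (@dyadic_step M B L _ _ m (k%:R * d)%:C) => //.
    - exact/kd/ltnW/ltnW/ltnW.
    - exact/kd/ltnW.
    - by rewrite nz ?td // mulrC -ler_pdivlMr // m0P.
    - rewrite -rmorphB normc_real -mulrBl -natrB ?leqW //.
      by rewrite subSn // subSn // subnn ger0_norm ?td.
  have -> : k.+1%:R * d = q * (k.+2%:R * d) by rewrite mulrA mulfVK.
  rewrite exprMn -mulrA; apply: (@le_trans _ _ (q ^+ (2 ^ m))).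
    by apply: ler_piMr => //; rewrite exprn_ge0 ?divr_ge0.
  have := m1P (2 ^ m)%N (leq_trans m1m (ltnW (ltn_expl m (ltnSn 1)))).
  by rewrite sub0r normrN; apply: le_trans; apply: ler_norm.
have [|m0 /(_ m0 (leqnn m0)) m0P] := small (2 ^ K0)%N _ 1 ltr01.
  by [].
exists (2 ^ m0)%N; first by rewrite expn_gt0.
apply: le_trans m0P; rewrite ler_wpM2r ?rnorm_ge0 //.
rewrite lerXn2r ?nnegrE ?td ?(ltW r0) //.
rewrite /d /M /K mulrA ler_pdivlMr //.
have : (1 : R) <= (2 ^ K0)%N%:R by rewrite ler1n expn_gt0.
rewrite -[(2 ^ K0).+2%:R]natr1 -natr1; nra.
Qed.

(** A single n with ||x^n|| <= e^n controls all the powers, by Euclidean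
    division of the exponent by n and submultiplicativity. *)
Lemma resolvent_everywhere_superexp : superexp_small (fun n => rnorm (x ^+ n)).
Proof.
move=> e e0; have [|n n0 xn] := @power_small e^-1; first by rewrite invr_gt0.
pose D := \sum_(i < n) rnorm (x ^+ i) / e ^+ i.
exists D; elim/ltn_ind => k IH.
have s0 i : 0 <= rnorm (x ^+ i) / e ^+ i.
  by rewrite divr_ge0 ?rnorm_ge0 ?exprn_ge0 // ltW.
have [nk|kn] := leqP n k; last first.
  rewrite -ler_pdivrMr ?exprn_gt0 // /D (bigD1 (Ordinal kn)) //= lerDl.
  exact: sumr_ge0.
have /IH kD : (k - n < k)%N by rewrite ltn_subrL n0 (leq_trans n0).
rewrite -(subnKC nk) !exprD; apply: le_trans (rnormM _ _) _.
rewrite mulrCA; apply: ler_pM; rewrite ?rnorm_ge0 //.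
by move: xn; rewrite exprVn mulrC ler_pdivrMr ?exprn_gt0 // mul1r.
Qed.

End Resolvent.

Section Quasinilpotent.
Variables (R : realType) (A : banachAlgType R[i]).
Implicit Types x : A.

Lemma quasinilpotent_superexp_small x :
  quasinilpotent x -> superexp_small (fun n => rnorm (x ^+ n)).
Proof.
move=> qx; apply: resolvent_everywhere_superexp => z.
have [->|z0] := eqVneq z 0; first by rewrite scale0r subr0 unitr1.
have : ~ spectrum x z^-1.
  by rewrite qx => /eqP; rewrite invr_eq0 (negPf z0).
rewrite /spectrum /= => /negP; rewrite negbK => /unitrP [w [wl wr]].
have E : 1 - z *: x = z *: (z^-1%:A - x).
  by rewrite scalerBr scalerA mulfV // scale1r.
apply/unitrP; exists (z^-1 *: w).
by rewrite E -!scalerAl -!scalerAr !scalerA wl wr mulVf ?mulfV // scale1r.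
Qed.

End Quasinilpotent.

(** * The socle of a semisimple Banach algebra *)

Section Jacobson.
Variables (R : realType) (A : banachAlgType R[i]).
Implicit Types (a b e f h u x y : A).

(** A maximal left ideal J that misses h satisfies A h + J = A, so that
    1 - x h lies in J for some x, and J contains no unit. *)
Lemma semisimple_semiprimitive : semisimple A ->
  forall h, h != 0 -> exists x, 1 - x * h \isn't a GRing.unit.
Proof.
move=> ssA h h0.
have /existsNP [J /not_implyP [Jmax hJ]] : ~ (@jacobson_radical R A) h.
  by rewrite ssA; apply/eqP.
have [[J0 J1 JM] Jm] := Jmax.
apply: contrapT => /forallNP xu.
pose J' : {pred A} :=
  [pred w | `[< exists2 j, j \in J & exists x, w = x * h + j >]].
have J'P w : reflect (exists2 j, j \in J & exists x, w = x * h + j) (w \in J').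
  by rewrite inE; apply: asboolP.
apply/hJ/(Jm J'); last 2 first.
- by move=> j jJ; apply/J'P; exists j => //; exists 0; rewrite mul0r add0r.
- by apply/J'P; exists 0 => //; exists 1; rewrite mul1r addr0.
split.
- by apply/J'P; exists 0 => //; exists 0; rewrite mul0r addr0.
- apply/J'P => -[j jJ [x E]]; have ux : 1 - x * h \is a GRing.unit.
    by apply: contraT => /xu.
  move/negP: J1; apply; rewrite -(mulVr ux).
  have -> : 1 - x * h = j by rewrite E addrC addrA addNr add0r.
  by rewrite -[_ * j]addr0 JM.
- move=> t u v /J'P [j jJ [x ->]] /J'P [k kJ [y ->]]; apply/J'P.
  exists (t * j + k); first exact: JM.
  by exists (t * x + y); rewrite mulrDr mulrDl addrACA mulrA.
Qed.

Lemma socle_algebraic a : semisimple A -> socle A a ->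
  forall x, algebraic (x * a).
Proof.
move=> /semisimple_semiprimitive ssA [us usP ->] x; rewrite mulr_sumr.
rewrite -(big_map (fun u => x * u) xpredT id).
apply: sum_thin_algebraic => // _ /mapP [u /usP [_ uT] ->].
exact: thinMl.
Qed.

Lemma counting_lt (S T : set R[i]) (g : R[i]) :
  finite_set S -> finite_set T -> S `<=` T -> T g -> ~ S g ->
  (counting S < (counting T : \bar R))%E.
Proof.
move=> Sf Tf ST Tg Sg; rewrite /counting !asboolT //= lte_fin ltr_nat.
apply/finmap.fproper_ltn_card/andP; split; first by rewrite -fset_set_sub.
by apply/negP; rewrite -fset_set_sub // => TS; exact/Sg/TS.
Qed.

(** Otherwise the nonzero spectrum of x a, which is finite, would strictly
    contain that of y a. *)
Lemma rank_maximal a y : semisimple A -> socle A a ->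
  counting (nz_spectrum (y * a)) = rank a ->
  forall x (g : R[i]),
  (forall r, r != 0 -> r%:A - y * a \isn't a GRing.unit ->
     r%:A - x * a \isn't a GRing.unit) ->
  g != 0 -> g%:A - x * a \isn't a GRing.unit ->
  g%:A - y * a \isn't a GRing.unit.
Proof.
move=> ssA aS yr x g sub g0 gx; apply: contraT => gy; exfalso.
have fin w : finite_set (nz_spectrum (w * a)).
  have [rs rsP] := algebraic_spectrum_finite (socle_algebraic ssA aS w).
  by apply: sub_finite_set (finite_seq rs) => r [/rsP].
have lt : (counting (nz_spectrum (y * a)%R) <
    (counting (nz_spectrum (x * a)%R) : \bar R))%E.
  apply: (@counting_lt _ _ g) => //.
  - by move=> r [ry /eqP r0]; split; [exact: sub | exact/eqP].
  - by split=> //; apply/eqP.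
  - by case; rewrite /spectrum /= (negPf gy).
have := lt; rewrite yr ltNge => /negP; apply.
by apply: ereal_sup_ubound; exists x.
Qed.

End Jacobson.

(** * Consequences of quasinilpotent equivalence *)

Section Spectral.
Variables (R : realType) (A : banachAlgType R[i]).
Implicit Types (a b e f h u x y : A).

(** A vector killed on the left by every block is fixed by every 1 - ae.2,
    hence by their product 0; the same argument on the right completes it. *)
Lemma prod_compl_resolution (es : seq (R[i] * A)) w :
  \prod_(ae <- es) (1 - ae.2) = 0 ->
  (forall ae ae', ae \in es -> ae' \in es -> ae.2 * w * ae'.2 = 0) -> w = 0.
Proof.
move=> es0 ewe.
have left (v : A) : (forall ae, ae \in es -> ae.2 * v = 0) -> v = 0.
  move=> ev; rewrite -(mul0r v) -es0; elim: es {es0 ewe} ev => [|ae es IH] ev.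
    by rewrite big_nil mul1r.
  rewrite big_cons -mulrA -IH => [|ae' ae'es]; last first.
    by rewrite ev // inE ae'es orbT.
  by rewrite mulrBl mul1r ev ?mem_head // subr0.
have right (v : A) : (forall ae, ae \in es -> v * ae.2 = 0) -> v = 0.
  move=> ve; rewrite -(mulr0 v) -es0.
  elim: es {es0 ewe left} ve => [|ae es IH] ve.
    by rewrite big_nil mulr1.
  rewrite big_cons mulrA mulrBr mulr1 ve ?mem_head // subr0.
  by apply: IH => ae' ae'es; rewrite ve // inE ae'es orbT.
apply: left => ae aees; apply: right => ae' ae'es; exact: ewe.
Qed.

Lemma mul_iter_commop a b e (al : R[i]) n : e * a = al *: e ->
  e * iter n (commop a b) 1 = e * (al%:A - b) ^+ n.
Proof.
move=> ea; elim: n => [|n IH] //=.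
rewrite exprSr mulrA -IH /commop mulrBr mulrA ea -scalerAl.
by rewrite mulrBr -scalerAr mulr1 !mulrA.
Qed.

Lemma iter_commop_mul a b f (be : R[i]) n : a * f = be *: f ->
  iter n (commop b a) 1 * f = (b - be%:A) ^+ n * f.
Proof.
move=> af; elim: n => [|n IH] //=.
rewrite exprS -mulrA -IH /commop mulrBl -!mulrA af.
by rewrite mulrBl -scalerAr -scalerAl mul1r.
Qed.

Lemma iter_commop_comm a b n : a * b = b * a ->
  iter n (commop a b) 1 = (a - b) ^+ n.
Proof.
move=> ab; elim: n => [|n IH] //=; rewrite IH exprS /commop mulrBl.
by congr (_ - _); apply/esym/commrX; rewrite /GRing.comm mulrBl mulrBr ab.
Qed.

Lemma rnorm_sum (I : Type) (r : seq I) (F : I -> A) :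
  rnorm (\sum_(i <- r) F i) <= \sum_(i <- r) rnorm (F i).
Proof.
elim/big_rec2: _ => [|i s t _ h]; first by rewrite /rnorm normr0.
by apply: le_trans (rnormD _ _) _; rewrite lerD2l.
Qed.

Lemma rnormMn x n : rnorm (x *+ n) <= rnorm x *+ n.
Proof.
elim: n => [|n IH]; first by rewrite !mulr0n /rnorm normr0.
by rewrite !mulrS; apply: le_trans (rnormD _ _) _; rewrite lerD2l.
Qed.

(** With s = al - b and t = b - be, the scalar al - be is s + t, so
    (al - be)^n e b f is the binomial sum of the (e s^(n-i)) b (t^i f).  If the
    two outer factors decay at rate q = |al - be| / 4, the sum is
    O((2 q)^n), that is, ||e b f|| = O(2^-n). *)
Lemma separated_blocks a b e f (al be : R[i]) : al != be ->
  superexp_small (fun n => rnorm (e * (al%:A - b) ^+ n)) ->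
  superexp_small (fun n => rnorm ((b - be%:A) ^+ n * f)) ->
  e * b * f = 0.
Proof.
move=> albe es fs; apply: rnorm_eq0; apply/eqP; rewrite eq_le rnorm_ge0 andbT.
pose s := al%:A - b; pose t := b - be%:A.
have d0 : 0 < normc (al - be) by rewrite -ltcR -normcE normr_gt0 subr_eq0.
pose q := normc (al - be) / 4; have q0 : 0 < q by rewrite divr_gt0.
have [D1 eD] := es _ q0; have [D2 fD] := fs _ q0.
apply: (@le0_of_half_pow _ _ (D1 * rnorm b * D2)) => n.
have st : s + t = (al - be)%:A by rewrite addrA subrK scalerBl.
have cb (z : R[i]) : GRing.comm b z%:A.
  by rewrite /GRing.comm -scalerAl -scalerAr mul1r mulr1.
have bs : GRing.comm b s by apply: commrB (cb _) (commr_refl _).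
have cst : GRing.comm s t.
  apply: commrB; first exact/commr_sym.
  by rewrite /GRing.comm -scalerAl -scalerAr mul1r mulr1.
have E : (al - be) ^+ n *: (e * b * f) =
    \sum_(i < n.+1) (e * s ^+ (n - i) * b * (t ^+ i * f)) *+ 'C(n, i).
  have -> : (al - be) ^+ n *: (e * b * f) = e * b * (s + t) ^+ n * f.
    by rewrite st exprZn expr1n -scalerAr mulr1 -scalerAl.
  rewrite exprDn_comm // mulr_sumr mulr_suml; apply: eq_bigr => i _.
  rewrite mulrnAr mulrnAl; congr (_ *+ _); rewrite !mulrA.
  by rewrite -(mulrA e b) (commrX (n - i) bs) !mulrA.
have : normc (al - be) ^+ n * rnorm (e * b * f) <=
    D1 * rnorm b * D2 * (q + q) ^+ n.
  rewrite -normcX -rnormZ E; apply: le_trans (rnorm_sum _ _) _.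
  rewrite exprDn mulr_sumr; apply: ler_sum => i _.
  apply: le_trans (rnormMn _ _) _; rewrite mulrnAr lerMn2r; apply/orP; right.
  apply: le_trans (rnormM _ _) _.
  have -> : D1 * rnorm b * D2 * (q ^+ (n - i) * q ^+ i) =
      (D1 * q ^+ (n - i) * rnorm b) * (D2 * q ^+ i) by ring.
  apply: ler_pM; rewrite ?rnorm_ge0 ?fD //.
  by apply: le_trans (rnormM _ _) _; rewrite ler_wpM2r ?rnorm_ge0 ?eD.
rewrite -ler_pdivlMl ?exprn_gt0 // => /le_trans; apply.
rewrite mulrCA -exprVn -exprMn /q.
have -> // : (normc (al - be))^-1 *
    (normc (al - be) / 4 + normc (al - be) / 4) = 2^-1.
by field; rewrite gt_eqF.
Qed.

Lemma superexp_small_mull e (u : nat -> A) :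
  superexp_small (fun n => rnorm (u n)) ->
  superexp_small (fun n => rnorm (e * u n)).
Proof.
move=> us d /us [D uD]; exists (rnorm e * D) => n.
by apply: le_trans (rnormM _ _) _; rewrite -mulrA ler_wpM2l ?rnorm_ge0.
Qed.

Lemma superexp_small_mulr e (u : nat -> A) :
  superexp_small (fun n => rnorm (u n)) ->
  superexp_small (fun n => rnorm (u n * e)).
Proof.
move=> us d /us [D uD]; exists (D * rnorm e) => n.
by apply: le_trans (rnormM _ _) _; rewrite mulrAC ler_wpM2r ?rnorm_ge0.
Qed.

Lemma dist_rho_eq0 a b : dist_rho a b = 0%E <->
  superexp_small (fun n => rnorm (iter n (commop a b) 1)) /\
  superexp_small (fun n => rnorm (iter n (commop b a) 1)).
Proof.
have E u v : (rho u v <= 0)%E <->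
    superexp_small (fun n => rnorm (iter n (commop u v) 1)).
  by apply: limn_esup_root_le0 => n; apply: rnorm_ge0.
have d0 : (0 <= dist_rho a b)%E.
  by rewrite /dist_rho le_max; apply/orP; left; exact: limn_esup_root_ge0.
split=> [ab0|[/E ab /E ba]].
  have : (dist_rho a b <= 0)%E by rewrite ab0.
  by rewrite /dist_rho ge_max => /andP [/E ? /E ?].
apply/eqP; rewrite eq_le; apply/andP; split; last exact: d0.
rewrite /dist_rho ge_max; apply/andP; exact: (conj ab ba).
Qed.

End Spectral.

Theorem theorem4p7 (R : realType) (A : banachAlgType R[i])
    (hA : semisimple A) (a : A) (ha : socle A a)
    (hrank : assumes_rank_on_comm a) (b : A) :
  dist_rho a b = 0%E <-> quasinilpotent (a - b) /\ a * b = b * a.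
Proof.
split=> [/dist_rho_eq0 [sab sba]|[qab ab]]; last first.
  apply/dist_rho_eq0; have sq := quasinilpotent_superexp_small qab.
  split=> e /sq [D sD]; exists D => n; first by rewrite iter_commop_comm.
  rewrite iter_commop_comm // -opprB exprNn -signr_odd.
  by case: odd; rewrite ?expr1 ?expr0 ?mul1r ?mulN1r ?rnormN.
have [y ya yr] := hrank.
have [es [esa es0]] := scalar_blocks (semisimple_semiprimitive hA)
  (socle_algebraic hA ha) ya (rank_maximal hA ha yr).
have ab : a * b = b * a.
  apply/eqP; rewrite -subr_eq0; apply/eqP.
  apply: (prod_compl_resolution es0).
  move=> -[al e] [be f] /esa [/= ea _] /esa [_ /= af].
  have -> : e * (a * b - b * a) * f = (al - be) *: (e * b * f).
    rewrite mulrBr mulrBl !mulrA ea -!scalerAl -[e * b * a * f]mulrA af.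
    by rewrite -scalerAr -scalerBl.
  have [->|albe] := eqVneq al be; first by rewrite subrr scale0r.
  rewrite (@separated_blocks _ _ a b e f al be) ?scaler0 //.
  - move=> d /(superexp_small_mull e sab) [D sD]; exists D => n.
    by rewrite -(mul_iter_commop _ _ ea).
  - move=> d /(superexp_small_mulr f sba) [D sD]; exists D => n.
    by rewrite -(iter_commop_mul _ _ af).
split=> //; apply: superexp_small_quasinilpotent => e /sab [D sD].
by exists D => n; rewrite -iter_commop_comm.
Qed.
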